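(* Let $\{x_k\}$ be a sequence of real numbers converging to $x_*$ with $x_k \neq x_*$ for all large $k$, and let $p \in \mathbb{N}$. Suppose $\{x_k\}$ converges with $p$-step Q-order at least $\alpha$ for some $\alpha > 1$. Then for every $\tilde{\alpha} \in [1,\alpha)$, the sequence $\{x_k\}$ converges with $p$-step Q-superorder at least $\tilde{\alpha}$. In particular, it converges with $p$-step Q-order at least $\tilde{\alpha}$.
   Context: $\mathbb{N} = \{1,2,\dots\}$; sequences are indexed by integers $k \geq 0$. For a sequence $\{x_k\}$ of real numbers converging to $x_*$, with $x_k \neq x_*$ for all large $k$, put $e_k = |x_k - x_*|$. All quotients below are considered for $k$ large enough that they are defined, and limits superior are taken in $[0,+\infty]$. For $p \in \mathbb{N}$ and $\alpha \geq 1$ define $$Q_1^{(p)}(x_k) = \left(\frac{e_{k+p}}{e_k}\right)^{1/p}, \qquad Q_\alpha^{(p)}(x_k) = \left(\frac{e_{k+p}}{e_k^{\alpha^p}}\right)^{\frac{\alpha-1}{\alpha^p-1}} \ \text{ if } \alpha>1, \qquad \overline{Q}_\alpha^{(p)}(x_k) = \limsup_{k\to\infty} Q_\alpha^{(p)}(x_k).$$ The sequence $\{x_k\}$ converges with $p$-step Q-order at least $1$ if $\overline{Q}_1^{(p)}(x_k) < 1$, and with $p$-step Q-order at least $\alpha$, for $\alpha > 1$, if $\overline{Q}_\alpha^{(p)}(x_k) < \infty$. For $\alpha \geq 1$, it converges with $p$-step Q-superorder at least $\alpha$ if $\overline{Q}_\alpha^{(p)}(x_k) = 0$. *)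

(* Defs.v *)
From HB Require Import structures.
From mathcomp Require Import all_boot all_order all_algebra.
From mathcomp Require Import all_classical all_reals all_analysis.

Set Implicit Arguments.
Unset Strict Implicit.
Unset Printing Implicit Defensive.

Import Order.TTheory GRing.Theory Num.Theory.
Import numFieldNormedType.Exports.

Local Open Scope classical_set_scope.
Local Open Scope ring_scope.

Definition err {R : realType} (x : nat -> R) (xs : R) (k : nat) : R :=
  `|x k - xs|.

(* Meaningful for 0 < p and 1 <= alpha. Division and powers are total, so the
   quotient gets a junk value where err x xs k = 0; when x k != xs for all large
   k, these are finitely many indices and do not affect limits superior. *)
Definition Qfactor {R : realType} (p : nat) (alpha : R) (x : nat -> R) (xs : R)
    (k : nat) : R :=
  if alpha == 1 then (err x xs (k + p)%N / err x xs k) `^ (p%:R^-1)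
  else (err x xs (k + p)%N / err x xs k `^ (alpha ^+ p))
         `^ ((alpha - 1) / (alpha ^+ p - 1)).

Definition Qbar {R : realType} (p : nat) (alpha : R) (x : nat -> R) (xs : R) :
    \bar R :=
  limn_esup (fun k => (Qfactor p alpha x xs k)%:E).

Definition Qorder_at_least {R : realType} (p : nat) (alpha : R) (x : nat -> R)
    (xs : R) : Prop :=
  if alpha == 1 then (Qbar p alpha x xs < 1%:E)%E
  else (Qbar p alpha x xs < +oo)%E.

Definition Qsuperorder_at_least {R : realType} (p : nat) (alpha : R)
    (x : nat -> R) (xs : R) : Prop :=
  Qbar p alpha x xs = 0%E.

(* Main.v *)
Require Import Defs.
From mathcomp Require Import all_boot all_order all_algebra.
From mathcomp Require Import all_classical all_reals all_analysis.
Import Order.TTheory GRing.Theory Num.Theory.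
Import numFieldNormedType.Exports.
Local Open Scope classical_set_scope.
Local Open Scope ring_scope.

(** Write r_k(b) = e_{k+p} / e_k^(b^p), so that the Q-factor of order b is a
    fixed positive power of r_k(b). A finite limit superior for alpha makes
    r_k(alpha) eventually bounded, and for alpha' < alpha
    r_k(alpha') = r_k(alpha) * e_k^(alpha^p - alpha'^p), a bounded quantity times
    a positive power of e_k, tends to 0. *)

(** Since [c]-th powers are strictly increasing on nonnegative reals, [f t < e^(1/c)] gives
    [f t ^ c < e]. *)
Lemma cvg_powR0 (R : realType) (T : Type) (F : set_system T) (FF : Filter F)
    (f : T -> R) (c : R) : 0 < c -> (forall t, 0 <= f t) ->
  f t @[t --> F] --> 0 -> f t `^ c @[t --> F] --> 0.
Proof.
move=> c_gt0 f_ge0 f0; apply/cvgr0Pnorm_lt => e e_gt0.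
have := f0; move/cvgr0Pnorm_lt => /(_ _ (powR_gt0 c^-1 e_gt0)).
apply: filterS => t; rewrite !ger0_norm ?powR_ge0 // => ft_lt.
have -> : e = (e `^ c^-1) `^ c by rewrite -powRrM mulVf ?gt_eqF// powRr1 // ltW.
by apply: gt0_ltr_powR => //; rewrite nnegrE ?powR_ge0.
Qed.

(** The limit superior is the infimum, over neighbourhoods [V] of infinity, of the supremum of [u]
    on [V]; if it is below [+oo], so is one of these suprema. *)
Lemma limn_esup_lty (R : realType) (u : nat -> \bar R) :
  (limn_esup u < +oo)%E -> exists M : R, \forall k \near \oo, (u k <= M%:E)%E.
Proof.
move=> /ereal_inf_lt[_ [V nV <-] supV].
have [M ubM] : exists M : R, (ereal_sup (u @` V) <= M%:E)%E.
  (* A supremum equal to [-oo] lies below any real; 0 is chosen. *)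
  case: (ereal_sup _) supV => [r _| //|_]; first by exists r.
  by exists 0; rewrite leNye.
exists M; apply: filterS nV => k Vk; apply: le_trans ubM.
by apply: ereal_sup_ubound; exists k.
Qed.

(** Merges the two cases of [Qfactor]: for [b = 1] the inner exponent [b ^+ p] is 1, and for [b > 1]
    the outer exponent is positive because [b ^+ p > 1]. *)
Lemma QfactorE (R : realType) (p : nat) (b : R) (x : nat -> R) (xs : R) :
  (0 < p)%N -> 1 <= b -> exists2 c : R, 0 < c & forall k,
    Qfactor p b x xs k = (err x xs (k + p) / err x xs k `^ (b ^+ p)) `^ c.
Proof.
move=> p_gt0; rewrite le_eqVlt => /orP[/eqP <-|b_gt1].
  exists p%:R^-1; first by rewrite invr_gt0 ltr0n.
  by move=> k; rewrite /Qfactor eqxx expr1n powRr1 // normr_ge0.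
exists ((b - 1) / (b ^+ p - 1)).
  by rewrite divr_gt0 // subr_gt0 // exprn_egt1 // -lt0n.
by move=> k; rewrite /Qfactor gt_eqF.
Qed.

Lemma powR_le_inv (R : realType) (a c M : R) :
  0 < c -> 0 <= a -> a `^ c <= M -> a <= M `^ c^-1.
Proof.
move=> c_gt0 a_ge0 aM.
rewrite -[leLHS]powRr1 // -(@mulfV _ c) ?gt_eqF// powRrM.
have M_ge0 : 0 <= M by exact: le_trans (powR_ge0 _ _) aM.
by apply: ge0_ler_powR; rewrite ?invr_ge0 ?nnegrE ?powR_ge0 ?(ltW c_gt0).
Qed.

Theorem proposition2 (R : realType) (x : nat -> R) (xs : R) (p : nat)
    (x_cvg : x k @[k --> \oo] --> xs)
    (x_neq : \forall k \near \oo, x k != xs)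
    (p_gt0 : (0 < p)%N)
    (alpha : R) (alpha_gt1 : 1 < alpha)
    (x_order : Qorder_at_least p alpha x xs) :
  forall alpha' : R, 1 <= alpha' -> alpha' < alpha ->
    Qsuperorder_at_least p alpha' x xs /\ Qorder_at_least p alpha' x xs.
Proof.
move=> b b_ge1 b_lt.
(* A zero limit superior is below both thresholds, 1 and [+oo]. *)
suff super : Qsuperorder_at_least p b x xs.
  split; first exact: super.
  rewrite /Qorder_at_least; move: super; rewrite /Qsuperorder_at_least => ->.
  by case: ifP => _; [rewrite lte_fin ltr01|exact: ltry].
have e_ge0 k : 0 <= err x xs k by exact: normr_ge0.
have e0 : err x xs k @[k --> \oo] --> 0.
  by apply/norm_cvg0P/subr_cvg0.
pose r a k := err x xs (k + p) / err x xs k `^ (a ^+ p).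
have r_ge0 a k : 0 <= r a k by rewrite divr_ge0 ?powR_ge0.
have [C rC] : exists C : R, \forall k \near \oo, r alpha k <= C.
  move: x_order; rewrite /Qorder_at_least gt_eqF // => /limn_esup_lty[M QM].
  have [c c_gt0 Qc] := QfactorE R p alpha x xs p_gt0 (ltW alpha_gt1).
  (* Undoing the outer power [c] turns the bound [M] on the Q-factor into a bound on [r alpha k]. *)
  exists (M `^ c^-1); apply: filterS QM => k; rewrite lee_fin Qc.
  exact: powR_le_inv c_gt0 (r_ge0 alpha k).
pose d := alpha ^+ p - b ^+ p.
have d_gt0 : 0 < d.
  by rewrite subr_gt0 ltrXn2r ?(le_trans ler01 b_ge1)//; exact: lt0n_neq0.
have rb0 : r b k @[k --> \oo] --> 0.
  have Ce0 : C * err x xs k `^ d @[k --> \oo] --> 0.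
    by rewrite -(mulr0 C); apply: cvgMl_tmp; exact: cvg_powR0.
  (* Squeeze: eventually [0 <= r b k <= C * e_k^d]. *)
  apply: (squeeze_cvgr _ (cvg_cst 0) Ce0).
  near=> k; rewrite r_ge0 /=.
  have e_neq0 : err x xs k != 0 by rewrite normr_eq0 subr_eq0; near: k.
  (* Splitting [e_k^d] as a quotient and cancelling [e_k^(alpha^p)] relies on [e_k] being
     nonzero. *)
  have -> : r b k = r alpha k * err x xs k `^ d.
    rewrite /r /d powRB ?e_neq0 ?implybT // mulrA divfK //.
    by rewrite powR_eq0 (negPf e_neq0).
  by apply: ler_wpM2r; [exact: powR_ge0|near: k].
have [c c_gt0 Qc] := QfactorE R p b x xs p_gt0 b_ge1.
have Q0 : (Qfactor p b x xs k)%:E @[k --> \oo] --> 0%E.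
  apply: cvg_EFin; first by apply: nearW.
  under eq_fun do rewrite /= Qc.
  exact: cvg_powR0 c_gt0 (r_ge0 b) rb0.
by rewrite /Qsuperorder_at_least /Qbar (cvg_limn_einf_sup Q0).2.
Unshelve. all: by end_near.
Qed.
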